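(* Let $N:\mathfrak g\to\mathfrak g$ be a Nijenhuis operator on an $n$-Lie algebra $\mathfrak g$ over a field $\mathbb F$. Then for any polynomial $P(z)=\sum_{i=0}^{k}c_iz^i$ with coefficients $c_i\in\mathbb F$, the operator $P(N)$ is also a Nijenhuis operator on $\mathfrak g$. Furthermore, if $N$ is invertible, then for any Laurent polynomial $Q(z)=\sum_{i=-m}^{k}c_iz^i$ with coefficients in $\mathbb F$, the operator $Q(N)$ is also a Nijenhuis operator on $\mathfrak g$.
   Context: Let $n\ge 2$. An $n$-Lie algebra is a vector space $\mathfrak g$ with an $n$-multilinear skew-symmetric bracket $[\cdot,\dots,\cdot]:\wedge^n\mathfrak g\to\mathfrak g$ satisfying $[x_1,\dots,x_{n-1},[y_1,\dots,y_n]]=\sum_{i=1}^n[y_1,\dots,[x_1,\dots,x_{n-1},y_i],\dots,y_n]$ for all $x_i,y_i\in\mathfrak g$. For a linear map $N:\mathfrak g\to\mathfrak g$ define $n$-ary brackets $[\cdot,\dots,\cdot]_N^j$, $1\le j\le n-1$, by $[x_1,\dots,x_n]_N^1=\sum_{i=1}^n[x_1,\dots,Nx_i,\dots,x_n]-N[x_1,\dots,x_n]$ and, for $2\le j\le n-1$, $[x_1,\dots,x_n]_N^j=\sum_{i_1<\dots<i_j}[\dots,Nx_{i_1},\dots,Nx_{i_j},\dots]-N[x_1,\dots,x_n]_N^{j-1}$, where in the summand $N$ is applied exactly to the entries in positions $i_1,\dots,i_j$. The linear map $N$ is a Nijenhuis operator if $[Nx_1,\dots,Nx_n]=N([x_1,\dots,x_n]_N^{n-1})$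 for all $x_1,\dots,x_n\in\mathfrak g$. *)

(* Defs.v *)
From mathcomp Require Import all_boot all_order all_algebra.

Set Implicit Arguments.
Unset Strict Implicit.
Unset Printing Implicit Defensive.

Import GRing.Theory.
Local Open Scope ring_scope.

Section NLie.
Variables (F : fieldType) (g : lmodType F) (n : nat).
Implicit Types (N M : g -> g) (x y : {ffun 'I_n -> g}) (i : 'I_n) (u v : g).

Definition upd x i u : {ffun 'I_n -> g} :=
  [ffun j => if j == i then u else x j].

(* The n-tuple (x_1, ..., x_{n-1}, u): [insub] fails exactly on the last index. *)
Definition append (x : {ffun 'I_n.-1 -> g}) u : {ffun 'I_n -> g} :=
  [ffun i : 'I_n => oapp x u (insub (val i))].

(* The bracket is a map on the n-th exterior power, so skew-symmetry is taken
   in the alternating sense, which matters only in characteristic 2. *)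
Record is_nLie_bracket (br : {ffun 'I_n -> g} -> g) : Prop := {
  nLie_multilinear : forall x i (a : F) u v,
    br (upd x i (a *: u + v)) = a *: br (upd x i u) + br (upd x i v);
  nLie_alternating : forall x i j, i != j -> x i = x j -> br x = 0;
  nLie_fundamental : forall (x : {ffun 'I_n.-1 -> g}) y,
    br (append x (br y)) = \sum_(i < n) br (upd y i (br (append x (y i))))
}.

Definition apply_on N (S : {set 'I_n}) x : {ffun 'I_n -> g} :=
  [ffun i => if i \in S then N (x i) else x i].

(* The index sets i_1 < ... < i_j are the subsets of cardinality j. For j = 0
   this is the bracket itself, so that j = 1 obeys the same recursion. *)
Fixpoint deformed_bracket (br : {ffun 'I_n -> g} -> g) N (j : nat) x : g :=
  if j is j'.+1 then
    \sum_(S : {set 'I_n} | #|S| == j) br (apply_on N S x)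
      - N (deformed_bracket br N j' x)
  else br x.

Definition is_nijenhuis (br : {ffun 'I_n -> g} -> g) N : Prop :=
  linear N /\
  forall x, br [ffun i => N (x i)] = N (deformed_bracket br N n.-1 x).

Definition poly_op (p : {poly F}) N (u : g) : g :=
  \sum_(i < size p) p`_i *: iter i N u.

(* N^e for an integer e, where M stands for the inverse of N;
   Negz k is the integer -(k+1). *)
Definition zpow_op N M (e : int) (u : g) : g :=
  match e with
  | Posz k => iter k N u
  | Negz k => iter k.+1 M u
  end.

(* The sum of c_e N^e over -m <= e <= k, reindexed by e = i - m. *)
Definition laurent_op (m k : nat) (c : int -> F) N M (u : g) : g :=
  \sum_(i < (m + k)%N.+1) c (i%:Z - m%:Z) *: zpow_op N M (i%:Z - m%:Z) u.

End NLie.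

(* Main.v *)
Require Import Defs.
From HB Require Import structures.
From mathcomp Require Import all_boot all_order all_algebra.

(** On the maps from [g^n] to [g], let [X_i] be precomposition with [N] in the
    [i]-th slot and [Y] postcomposition with [N]; these operators commute.
    Unfolding the recursion for the deformed brackets, [N] is a Nijenhuis
    operator iff [\prod_i (X_i - Y)] kills the bracket.  If [M] is a polynomial
    in [N] (or a Laurent polynomial, when [N] is invertible), the corresponding
    difference for [M] in each slot is a multiple of [X_i - Y], so the product
    for [M] kills the bracket as well. *)

Set Implicit Arguments.
Unset Strict Implicit.
Unset Printing Implicit Defensive.

Import GRing.Theory.
Local Open Scope ring_scope.

Section SlotDefects.
Variables (F : fieldType) (g : lmodType F) (n : nat).
Implicit Types (N M L : g -> g) (x : {ffun 'I_n -> g}) (i j : 'I_n) (u v : g).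
Implicit Types (f h : {ffun 'I_n -> g} -> g) (s : seq 'I_n) (S : {set 'I_n}).

Definition linear_of M (hM : linear M) : {linear g -> g} :=
  HB.pack M (GRing.isLinear.Build F g g *:%R M hM).

Lemma linear_fun0 M : linear M -> M 0 = 0.
Proof. by move=> hM; exact: (linear0 (linear_of hM)). Qed.

Lemma linear_funB M : linear M -> {morph M : u v / u - v}.
Proof. by move=> hM; exact: (linearB (linear_of hM)). Qed.

Lemma linear_funD M : linear M -> {morph M : u v / u + v}.
Proof. by move=> hM; exact: (linearD (linear_of hM)). Qed.

Lemma linear_funN M : linear M -> {morph M : u / - u}.
Proof. by move=> hM; exact: (linearN (linear_of hM)). Qed.

Lemma linear_funZ M (a : F) : linear M -> {morph M : u / a *: u}.
Proof. by move=> hM; exact: (linearZ_LR (linear_of hM)). Qed.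

Lemma linear_fun_sum M (I : Type) (r : seq I) (P : pred I) (G : I -> g) :
  linear M -> M (\sum_(i <- r | P i) G i) = \sum_(i <- r | P i) M (G i).
Proof. by move=> hM; exact: (linear_sum (linear_of hM)). Qed.

(** * Slot operators, their differences and commutation *)

Definition slot_map M i x : {ffun 'I_n -> g} := upd x i (M (x i)).

Definition slot_linear f : Prop := forall x i (a : F) u v,
  f (upd x i (a *: u + v)) = a *: f (upd x i u) + f (upd x i v).

(** This is [X_i - Y] applied to [f]; [defects] applies the product of these operators over the
    slots in [s]. *)
Definition defect N i f x : g := f (slot_map N i x) - N (f x).

Definition defects N s f : {ffun 'I_n -> g} -> g := foldr (defect N) f s.

Lemma slot_mapC M N i j x : (forall u, M (N u) = N (M u)) ->
  slot_map M i (slot_map N j x) = slot_map N j (slot_map M i x).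
Proof.
move=> MN; apply/ffunP=> k; rewrite !ffunE.
by have [->|ki] := eqVneq k i; have [<-|kj] := eqVneq i j;
  rewrite ?eqxx ?(negPf ki) // eq_sym; case: eqVneq.
Qed.

Lemma upd_id x i u : upd (upd x i u) i =1 upd x i.
Proof. by move=> v; apply/ffunP=> k; rewrite !ffunE; case: eqP. Qed.

Lemma updC x i j u v : i != j -> upd (upd x i u) j v = upd (upd x j v) i u.
Proof.
move=> ij; apply/ffunP=> k; rewrite !ffunE.
by case: (eqVneq k j) => // ->; rewrite eq_sym (negPf ij).
Qed.

Lemma slot_map_upd M i x u : slot_map M i (upd x i u) = upd x i (M u).
Proof. by rewrite /slot_map upd_id ffunE eqxx. Qed.

Lemma slot_map_upd_neq M i j x u : i != j ->
  slot_map M i (upd x j u) = upd (slot_map M i x) j u.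
Proof. by move=> ij; rewrite /slot_map ffunE (negPf ij) updC // eq_sym. Qed.

Lemma slot_linear_defect N i f :
  linear N -> slot_linear f -> slot_linear (defect N i f).
Proof.
move=> hN hf x j a u v; rewrite /defect.
have [<-|ij] := eqVneq i j.
  by rewrite !slot_map_upd hN !hf hN scalerBr opprD addrACA.
by rewrite !slot_map_upd_neq // !hf hN scalerBr opprD addrACA.
Qed.

Lemma eq_defects N s f h : f =1 h -> defects N s f =1 defects N s h.
Proof.
by elim: s => //= i s IH fh x; rewrite /defect !(IH fh).
Qed.

Lemma defects_defect N s i f : linear N ->
  defects N s (defect N i f) =1 defect N i (defects N s f).
Proof.
move=> hN; elim: s => //= j s IH x.
(* Both sides expand into four terms; the outer ones agree because the slot maps commute, and the
   two mixed ones are interchanged. *)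
rewrite {1}/defect !IH /defect !(linear_funB hN) (slot_mapC i j) // !opprB.
by rewrite addrACA [RHS]addrACA; congr (_ + _); rewrite addrC.
Qed.

(** Postcomposition with [L] commutes with each [X_i] and, since [L] commutes with [N], also with
    [Y]; linearity carries it through the differences. *)
Lemma defects_post N s L f : linear N -> linear L ->
    (forall u, L (N u) = N (L u)) ->
  defects N s (fun x => L (f x)) =1 (fun x => L (defects N s f x)).
Proof.
move=> hN hL LN; elim: s => //= i s IH x.
by rewrite /defect !IH (linear_funB hL) LN.
Qed.

Lemma defects_pre N s M i f : (forall u, M (N u) = N (M u)) ->
  defects N s (fun x => f (slot_map M i x))
    =1 (fun x => defects N s f (slot_map M i x)).
Proof.
move=> MN; elim: s => //= j s IH x.
by rewrite /defect !IH (slot_mapC i j).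
Qed.

Lemma defectsD N s f h : linear N ->
  defects N s (fun x => f x + h x)
    =1 (fun x => defects N s f x + defects N s h x).
Proof.
move=> hN; elim: s => //= i s IH x.
by rewrite /defect !IH (linear_funD hN) opprD addrACA.
Qed.

Lemma defects0 N s : linear N -> defects N s (fun=> 0) =1 (fun=> 0).
Proof.
move=> hN; elim: s => //= i s IH x.
by rewrite /defect !IH (linear_fun0 hN) subrr.
Qed.

(* The difference for [M] in a slot lies in the ideal generated by the one for
   [N]: whatever else is needed to kill the latter also kills the former. *)
Definition dominates N M : Prop :=
  [/\ linear M, forall u, M (N u) = N (M u)
    & forall s i f, slot_linear f ->
        defects N s (defect N i f) =1 (fun=> 0) ->
        defects N s (defect M i f) =1 (fun=> 0)].

(** * Closure properties of domination *)

Section Dominates.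
Variables (N : g -> g) (hN : linear N).

Lemma dominates_id : dominates N id.
Proof.
split=> // s i f _ _ x.
rewrite -[RHS](defects0 s hN x); apply: eq_defects => y.
rewrite /defect; apply/eqP; rewrite subr_eq0; apply/eqP; congr f.
by apply/ffunP=> k; rewrite ffunE; case: eqP => // ->.
Qed.

Lemma dominates_comp M L :
  dominates N M -> dominates N L -> dominates N (fun u => M (L u)).
Proof.
move=> [hM MN domM] [hL LN domL]; split=> [a u v|u|s i f hf f0 x].
- by rewrite hL hM.
- by rewrite LN MN.
(* Telescoping in slot [i]: [X_M X_L - Y_M Y_L = (X_M - Y_M) X_L + Y_M (X_L - Y_L)]. *)
have E y : defect (fun u => M (L u)) i f y
    = defect M i f (slot_map L i y) + M (defect L i f y).
  by rewrite /defect slot_map_upd (linear_funB hM) addrA subrK.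
rewrite (eq_defects N s E) defectsD // defects_pre // defects_post //.
by rewrite domM // domL // (linear_fun0 hM) addr0.
Qed.

Lemma dominates_lincomb (I : Type) (r : seq I) (c : I -> F) (M : I -> g -> g) :
  (forall k, dominates N (M k)) ->
  dominates N (fun u => \sum_(k <- r) c k *: M k u).
Proof.
move=> dM; have lin : linear (fun u => \sum_(k <- r) c k *: M k u).
  move=> a u v; rewrite scaler_sumr -big_split; apply: eq_bigr => k _ /=.
  by have [-> _ _] := dM k; rewrite scalerDr !scalerA mulrC.
split=> // [u|].
  rewrite (linear_fun_sum _ _ _ hN); apply: eq_bigr => k _.
  by have [_ -> _] := dM k; rewrite (linear_funZ _ hN).
move=> s i f hf f0 x; elim: r {lin} => [|k r IH].
  rewrite -[RHS](defects0 s hN x); apply: eq_defects => y.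
  rewrite /defect /slot_map !big_nil subr0.
  (* The empty combination puts 0 into slot [i]. The coefficient -1 turns slot-linearity at zero
     vectors into [f = - f + f], so the value there is 0. *)
  have := hf y i (-1) 0 0; rewrite scaler0 addr0 => ->.
  by rewrite scaleN1r addNr.
have E y : defect (fun u => \sum_(k <- k :: r) c k *: M k u) i f y
    = c k *: defect (M k) i f y
      + defect (fun u => \sum_(k <- r) c k *: M k u) i f y.
  by rewrite /defect /slot_map !big_cons hf scalerBr opprD addrACA.
have [_ _ domk] := dM k.
rewrite (eq_defects N s E) defectsD // IH addr0.
have hL : linear (fun u => c k *: u : g).
  by move=> a u v; rewrite scalerDr !scalerA mulrC.
rewrite (defects_post _ _ hN hL) ?domk ?scaler0 //.
by move=> u; rewrite (linear_funZ _ hN).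
Qed.

Lemma dominates_iter M k : dominates N M -> dominates N (iter k M).
Proof.
move=> dM; elim: k => [|k IH]; first exact: dominates_id.
exact: (dominates_comp dM IH).
Qed.

(* [X^-1 - Y^-1 = - X^-1 Y^-1 (X - Y)] *)
Lemma dominates_inv M : cancel N M -> cancel M N -> dominates N M.
Proof.
move=> NK MK.
have hM : linear M by move=> a u v; rewrite -{1}[u]MK -{1}[v]MK -hN NK.
have MN u : M (N u) = N (M u) by rewrite NK MK.
split=> // s i f hf f0 x.
have E y : defect M i f y = - M (defect N i f (slot_map M i y)).
  rewrite /defect slot_map_upd MK (linear_funB hM) NK opprB.
  congr (_ - M (f _)).
  by apply/ffunP=> k; rewrite ffunE; case: eqP => // ->.
have hL : linear (fun u => - M u).
  by move=> a u v; rewrite hM opprD scalerN.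
rewrite (eq_defects N s E) (defects_post _ _ hN hL) //.
  by rewrite defects_pre // f0 (linear_fun0 hM) oppr0.
by move=> u; rewrite MN (linear_funN hN).
Qed.

(** Factors are exchanged one at a time: by commutativity the factor of slot [i] is moved next to
    [f], traded for that of [M], and absorbed into a new slot-linear function. This is why
    [dominates] quantifies over [s] and [f]. *)
Lemma defects_dominates M s f : dominates N M -> slot_linear f ->
  defects N s f =1 (fun=> 0) -> defects M s f =1 (fun=> 0).
Proof.
move=> [hM MN domM]; elim: s f => // i s IH f hf f0 x /=.
rewrite -defects_defect //; apply: IH => //; first exact: slot_linear_defect.
by apply: domM => // y; rewrite defects_defect //; exact: f0.
Qed.

End Dominates.

(** * Expansion over subsets of slots *)

Lemma apply_onU1 N i S x : i \notin S ->
  apply_on N S (slot_map N i x) = apply_on N (i |: S) x.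
Proof.
move=> iS; apply/ffunP=> k; rewrite !ffunE in_setU1.
by case: (eqVneq k i) => [->|_] //=; rewrite (negPf iS).
Qed.

Lemma big_subset_setU1 i S (G : {set 'I_n} -> g) : i \notin S ->
  \sum_(A : {set 'I_n} | A \subset i |: S) G A
    = \sum_(A : {set 'I_n} | A \subset S) G (i |: A)
      + \sum_(A : {set 'I_n} | A \subset S) G A.
Proof.
move=> iS; rewrite (bigID (fun A : {set 'I_n} => i \in A)) /=; congr (_ + _).
  rewrite (reindex_onto (fun A => i |: A) (fun A => A :\ i)) /=; last first.
    by move=> A /andP[_ iA]; rewrite setD1K.
  apply: eq_bigl => A; rewrite setU11 andbT subUset sub1set setU11 /=.
  apply/andP/idP => [[AS /eqP <-]|AS].
    by rewrite subDset subUset subsetUl.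
  split; first by rewrite (subset_trans AS) // subsetUr.
  by apply/eqP; rewrite setU1K //; apply: contra iS; exact: (subsetP AS).
by apply: eq_bigl => A; rewrite -[in RHS](setU1K iS) subsetD1.
Qed.

(** Expanding the product of the [X_i - Y], the slots in [A] contribute [X_i] and each of the others
    contributes one [-Y]. *)
Lemma defectsE N s f x : linear N -> uniq s ->
  defects N s f x = \sum_(A : {set 'I_n} | A \subset [set i in s])
    iter (size s - #|A|) (fun u => - N u) (f (apply_on N A x)).
Proof.
move=> hN; elim: s x => [|i s IH] x /=.
  rewrite (big_pred1 set0); last by move=> A; rewrite set_nil subset0.
  by move=> _; congr f; apply/ffunP=> k; rewrite ffunE inE.
move=> /andP[is_ us]; rewrite set_cons.
have iS : i \notin [set j in s] by rewrite inE.
rewrite big_subset_setU1 // /defect !IH //; congr (_ + _).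
  apply: eq_bigr => A AS.
  have iA : i \notin A by apply: contra iS; exact: (subsetP AS).
  by rewrite apply_onU1 // cardsU1 iA add1n subSS.
rewrite (linear_fun_sum _ _ _ hN) -sumrN; apply: eq_bigr => A AS.
(* Slot [i] lies outside [A] and adds one [-N]; the truncated subtraction is exact because [A] has
   at most [size s] elements. *)
rewrite subSn //; apply: (leq_trans (subset_leq_card AS)).
by rewrite cardsE; exact: card_size.
Qed.

(** A set [A] enters the recursion at stage [#|A|], and each later stage applies one more [-N] to
    its term. *)
Lemma deformed_bracketE br N (j : nat) x : linear N ->
  deformed_bracket br N j x = \sum_(A : {set 'I_n} | (#|A| <= j)%N)
    iter (j - #|A|) (fun u => - N u) (br (apply_on N A x)).
Proof.
move=> hN; elim: j => [|j IH].
  rewrite (big_pred1 set0) => [|A]; last by rewrite leqn0 cards_eq0.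
  by rewrite /=; congr br; apply/ffunP=> k; rewrite ffunE inE.
rewrite [RHS](bigID (fun A : {set 'I_n} => #|A| == j.+1)) [LHS]/= IH.
congr (_ + _).
  apply: eq_big => [A|A /eqP ->]; last by rewrite subnn.
  by rewrite andbC; case: eqP => // ->; rewrite leqnn.
rewrite (linear_fun_sum _ _ _ hN) -sumrN; apply: eq_big => [A|A Aj].
  by rewrite andbC -ltn_neqAle.
by rewrite subSn.
Qed.

Lemma is_nijenhuisE br N : (0 < n)%N -> linear N ->
  is_nijenhuis br N <-> defects N (enum 'I_n) br =1 (fun=> 0).
Proof.
move=> n_gt0 hN.
have E x : defects N (enum 'I_n) br x
    = br [ffun i => N (x i)] - N (deformed_bracket br N n.-1 x).
  (* The recursion is run one stage past [n.-1]: the only set of [n] slots is the full one, so the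
     Nijenhuis equation says that the [n]-th deformed bracket vanishes. Here [0 < n] gives
     [n.-1.+1 = n]. *)
  have -> : br [ffun i => N (x i)] - N (deformed_bracket br N n.-1 x)
      = deformed_bracket br N n.-1.+1 x.
    rewrite /= (big_pred1 setT) => [|A].
      by congr (br _ - _); apply/ffunP=> k; rewrite !ffunE inE.
    have := max_card A; rewrite card_ord prednK // => leAn.
    by rewrite /= eqEcard subsetT cardsT card_ord eqn_leq leAn.
  (* Both expansions now run over all subsets of the slots, with the same exponents. *)
  rewrite deformed_bracketE // prednK // defectsE ?enum_uniq //.
  rewrite size_enum_ord; apply: eq_bigl => A.
  have := max_card A; rewrite card_ord => ->; apply/subsetP => k _.
  by rewrite inE mem_enum.
split=> [[_ hbr] x|hbr]; first by rewrite E hbr subrr.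
by split=> // x; apply/eqP; rewrite -subr_eq0 -E hbr.
Qed.

Lemma is_nijenhuis_dominates br N M : (0 < n)%N -> slot_linear br ->
  is_nijenhuis br N -> dominates N M -> is_nijenhuis br M.
Proof.
move=> n_gt0 hbr hN dM; have [linN _] := hN; have [linM _ _] := dM.
apply/is_nijenhuisE => //; apply: (defects_dominates linN dM hbr).
exact/is_nijenhuisE.
Qed.

End SlotDefects.

Theorem theorem3p12 (F : fieldType) (g : lmodType F) (n : nat) (hn : (2 <= n)%N)
    (br : {ffun 'I_n -> g} -> g) (hbr : is_nLie_bracket br)
    (N : g -> g) (hN : is_nijenhuis br N) :
  (forall P : {poly F}, is_nijenhuis br (poly_op P N)) /\
  (forall Ninv : g -> g, cancel N Ninv -> cancel Ninv N ->
   forall (m k : nat) (c : int -> F),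
     is_nijenhuis br (laurent_op m k c N Ninv)).
Proof.
have n_gt0 : (0 < n)%N by exact: ltnW.
have linN := proj1 hN.
have nij M : dominates n N M -> is_nijenhuis br M.
  by apply: is_nijenhuis_dominates hN => //; exact: nLie_multilinear hbr.
(* Both operators are linear combinations of powers, so it suffices to treat a single power; a
   Laurent exponent is split by sign into an iterate of [N] or of [Ninv]. *)
split=> [P|Ninv NK KN m k c]; apply: nij; apply: dominates_lincomb => // i.
  exact: dominates_iter.
by case: (_ - _) => e; apply: dominates_iter => //; exact: dominates_inv.
Qed.
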